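(* For every integer $L \geq 11$, all coefficients of the formal power series $G_{L,2}(q)+q^3$ are nonnegative.
   Context: A partition $\pi$ is a weakly decreasing finite list of positive integers (its parts); $|\pi|$ denotes the sum of its parts. Let $\mho$ be the set of partitions $\pi$ with $|\pi|>0$, and for $\pi \in \mho$ let $s(\pi)$ and $l(\pi)$ denote the smallest and largest parts of $\pi$, respectively. For a positive integer $L$, define $$G_{L,2}(q) = \sum_{\substack{\pi \in \mho,\\ s(\pi)=2,\\ l(\pi)-s(\pi)\leq L}} q^{|\pi|} - \sum_{\substack{\pi \in \mho,\\ s(\pi)\geq 3,\\ l(\pi)-s(\pi)\leq L}} q^{|\pi|}.$$ *)

(* Defs.v *)
From HB Require Import structures.
From mathcomp Require Import all_boot all_order all_algebra.

Set Implicit Arguments.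
Unset Strict Implicit.
Unset Printing Implicit Defensive.

Definition is_partition (s : seq nat) : bool :=
  sorted geq s && all (ltn 0) s.

Record int_partition := IntPartition {
  parts :> seq nat;
  partsP : is_partition parts }.

HB.instance Definition _ := [isSub for parts].
HB.instance Definition _ := [Countable of int_partition by <:].

Definition weight (pi : int_partition) : nat := sumn pi.

Definition in_mho (pi : int_partition) : bool := 0 < weight pi.

(* Parts are listed in weakly decreasing order, so the largest part comes first
   and the smallest last; both are 0 by convention on the empty partition. *)
Definition largest (pi : int_partition) : nat := head 0 pi.
Definition smallest (pi : int_partition) : nat := last 0 pi.

Lemma largest_in (pi : int_partition) : in_mho pi -> largest pi \in parts pi.
Proof. by case: pi => [[|x s] ?] //= _; rewrite /largest /= mem_head. Qed.

Lemma smallest_in (pi : int_partition) : in_mho pi -> smallest pi \in parts pi.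
Proof. by case: pi => [[|x s] ?] //= _; rewrite /smallest /= mem_last. Qed.

Lemma geq_trans : transitive geq.
Proof. by move=> y x z /= yx zy; apply: leq_trans zy yx. Qed.

Lemma largest_max (pi : int_partition) (x : nat) :
  x \in parts pi -> x <= largest pi.
Proof.
rewrite /largest; case/andP: (partsP pi) => + _.
case: (parts pi) => [|y s] //= /(order_path_min geq_trans) /allP ymax.
by rewrite inE => /predU1P[-> //|/ymax].
Qed.

Lemma smallest_min (pi : int_partition) (x : nat) :
  x \in parts pi -> smallest pi <= x.
Proof.
rewrite /smallest; case/andP: (partsP pi) => + _.
case/lastP: (parts pi) => [|s y] //.
rewrite last_rcons mem_rcons inE -[X in sorted _ X]revK rev_sorted rev_rcons /=.
move=> /(order_path_min leq_trans) /allP ymin /predU1P[-> //|xs].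
by apply: ymin; rewrite mem_rev.
Qed.

(* A partition of n has at most n parts, each at most n, so it occurs among the
   lists of length at most n over 'I_n.+1. *)
Definition partitions (n : nat) : seq int_partition :=
  [seq pi <- pmap insub [seq map val (bseqval s) | s : n.-bseq 'I_n.+1]
     | weight pi == n].

Lemma partitions_uniq (n : nat) : uniq (partitions n).
Proof.
apply/filter_uniq/pmap_sub_uniq; rewrite map_inj_uniq ?enum_uniq // => s t.
by move/(inj_map val_inj)/val_inj.
Qed.

Lemma mem_partitions (n : nat) (pi : int_partition) :
  (pi \in partitions n) = (weight pi == n).
Proof.
rewrite mem_filter andb_idr // => /eqP wpi; rewrite mem_pmap_sub /=.
have szpi : size pi <= n.
  rewrite -wpi /weight; case/andP: (partsP pi) => _.
  elim: (parts pi) => //= x s IH /andP[x0 /IH ss].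
  by rewrite -add1n leq_add.
have lepi x : x \in parts pi -> x < n.+1.
  rewrite ltnS -wpi /weight; elim: (parts pi) => //= y s IH.
  rewrite inE => /predU1P[->|/IH]; first exact: leq_addr.
  by move/leq_trans; apply; apply: leq_addl.
have szt : size (map (@inord n) pi) <= n by rewrite size_map.
apply/imageP; exists (Bseq szt) => //=.
rewrite -map_comp -[LHS]map_id; apply/eq_in_map => x /lepi xn /=.
by rewrite inordK.
Qed.

Import GRing.Theory.
Local Open Scope ring_scope.

(* A formal power series over int is given by its sequence of coefficients. *)
Definition fps := nat -> int.

Definition fps_add (f g : fps) : fps := fun n => f n + g n.
Definition fps_sub (f g : fps) : fps := fun n => f n - g n.
Definition fps_qpow (k : nat) : fps := fun n => (n == k)%:R.

(* The series \sum_(pi | P pi) q ^ weight pi over all partitions satisfying P;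
   its n-th coefficient is a finite sum by mem_partitions. *)
Definition partition_series (P : pred int_partition) : fps :=
  fun n => \sum_(pi <- partitions n | P pi) 1.

Definition G2 (L : nat) : fps :=
  fps_sub
    (partition_series (fun pi =>
       [&& in_mho pi, smallest pi == 2 & largest pi - smallest pi <= L]%N))
    (partition_series (fun pi =>
       [&& in_mho pi, 3 <= smallest pi & largest pi - smallest pi <= L]%N)).

(* Main.v *)
Require Import Defs.
From mathcomp Require Import all_boot all_order all_algebra.
From mathcomp Require Import zify.

Local Open Scope ring_scope.
Import Order.POrderTheory GRing.Theory Num.Theory.

Set Implicit Arguments.
Unset Strict Implicit.
Unset Printing Implicit Defensive.

(** Write p for the series of partitions with all parts in [3, L + 2], that is
    p = 1 / ((1 - q^3) ... (1 - q^(L+2))).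

    The two halves of G_{L,2} are both expressible through p.  A partition with
    smallest part 2 and parts at most L + 2 is a positive number of 2s followed
    by a partition counted by p, so the first half is
    p * (q^2 + q^4 + q^6 + ...) ([smallest2_rec]).  The second half telescopes
    over the smallest part to (p - 1) / (1 - q^L) ([narrow_rec]), a rewriting of
      (1 - q^L) * q^m / ((1 - q^m) ... (1 - q^(m+L)))
        = 1 / ((1 - q^m) ... (1 - q^(m+L-1)))
          - 1 / ((1 - q^(m+1)) ... (1 - q^(m+L))).

    Everything then rests on the estimate
      p(n) <= p(n-2) + p(n-4) + p(n-6) + [n = 0] + [n = 3],
    proved for parts in [3, M] by induction on M ([excess_bounds]).  The series
    of differences F_M between the two sides satisfies
      F_(M+1) = (F_M - q^(M+1) - q^(M+4)) / (1 - q^(M+1)),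
    so F_(M+1) has nonnegative coefficients when F_M does and those of F_M in
    degrees M + 1 and M + 4 are positive.  Enough degrees of F_M to keep this
    going are positive from M = 4 on, as one sees from
    F_3 = (q^2 + q^4) / (1 - q^3).

    To conclude, p(n) is absorbed by p(n-2) + p(n-4) + p(n-6), and p(n-L) by
    p(n-e) where e is the even one among L - 3 and L (adding a part 3 shows
    p(m) <= p(m+3)); the remaining terms of both halves are those at n - 2L,
    where strong induction applies.  The distance e must not be one of 2, 4, 6,
    which are spent on p(n); for odd L this says L - 3 > 6, hence L >= 11. *)

(** * Shifts of coefficient sequences *)

(** Multiplication by q^k. *)
Definition shift (k : nat) (f : fps) : fps :=
  fun n => if (k <= n)%N then f (n - k)%N else 0.

Lemma shift_comp j k f n : shift j (shift k f) n = shift (j + k) f n.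
Proof.
rewrite /shift; case: (leqP j n) => jn; last by rewrite ifN //; lia.
have -> : (j + k <= n)%N = (k <= n - j)%N by lia.
by case: ifP => // _; congr f; lia.
Qed.

Lemma shift_ge0 k f n : (forall m, 0 <= f m) -> 0 <= shift k f n.
Proof. by rewrite /shift => f0; case: ifP. Qed.

Lemma shift_qpow j k n : shift j (fps_qpow k) n = fps_qpow (j + k) n.
Proof.
rewrite /shift /fps_qpow; case: leqP => jn; last first.
  by rewrite (_ : _ == _ = false) //; lia.
by congr (_ %:R); congr nat_of_bool; lia.
Qed.

Lemma shift_add k f g h n :
  (forall m, f m = g m + h m) -> shift k f n = shift k g n + shift k h n.
Proof. by rewrite /shift => fgh; case: ifP; rewrite ?addr0. Qed.

(** * Partitions with parts in an interval *)

Definition within (a b : nat) (pi : int_partition) : bool :=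
  all (fun x => a <= x <= b)%N pi.

Definition parts_between (a b : nat) : fps := partition_series (within a b).

Lemma partition_series_ge0 P n : 0 <= partition_series P n.
Proof. exact: sumr_ge0. Qed.

Lemma eq_partition_series P Q n :
  (forall pi, weight pi = n -> P pi = Q pi) ->
  partition_series P n = partition_series Q n.
Proof.
move=> PQ; rewrite /partition_series big_seq_cond [RHS]big_seq_cond.
apply: eq_bigl => pi; rewrite mem_partitions; case: eqP => //= /PQ -> //.
Qed.

Lemma partition_series_split P Q n :
  partition_series P n = partition_series (fun pi => P pi && Q pi) n
                         + partition_series (fun pi => P pi && ~~ Q pi) n.
Proof. exact: bigID. Qed.

Fact insert_subproof (x : nat) (pi : int_partition) :
  is_partition (sort geq (x.+1 :: pi)).
Proof.
rewrite /is_partition all_sort sort_sorted => [/=|y z]; last exact: leq_total.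
by case/andP: (partsP pi).
Qed.

(** Inserts the part x + 1 rather than x, so that the result has positive parts
    without a side condition. *)
Definition insert x pi := IntPartition (insert_subproof x pi).

Fact delete_subproof (x : nat) (pi : int_partition) : is_partition (rem x pi).
Proof.
case/andP: (partsP pi) => srt pos; apply/andP; split.
  exact: subseq_sorted geq_trans _ _ (rem_subseq _ _) srt.
by apply/allP => y /mem_rem /(allP pos).
Qed.

Definition delete x pi := IntPartition (delete_subproof x pi).

(** Sorted lists are determined by their multisets of entries, so adding and
    deleting parts can be compared up to permutation. *)
Lemma perm_parts_inj (pi rho : int_partition) : perm_eq pi rho -> pi = rho.
Proof.
move=> pr; apply: val_inj => /=.
have geq_anti : antisymmetric geq.
  by move=> x y /andP[yx xy]; apply/eqP; rewrite eqn_leq; apply/andP.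
apply: (sorted_eq geq_trans geq_anti) => //.
  by case/andP: (partsP pi).
by case/andP: (partsP rho).
Qed.

Lemma perm_insert x pi : perm_eq (insert x pi) (x.+1 :: pi).
Proof. by rewrite perm_sort. Qed.

Lemma insertK x : cancel (insert x) (delete x.+1).
Proof.
move=> pi; apply: perm_parts_inj => /=.
rewrite -(perm_cons x.+1) perm_sym -(permPl (perm_insert x pi)).
by apply: perm_to_rem; rewrite mem_sort mem_head.
Qed.

Lemma deleteK x (pi : int_partition) :
  x.+1 \in parts pi -> insert x (delete x.+1 pi) = pi.
Proof.
move=> xpi; apply: perm_parts_inj; rewrite (permPl (perm_insert _ _)) perm_sym.
exact: perm_to_rem.
Qed.

Lemma weight_insert x pi : weight (insert x pi) = (x.+1 + weight pi)%N.
Proof. by rewrite /weight (perm_sumn (perm_insert x pi)). Qed.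

Lemma within_insert a b x pi :
  within a b (insert x pi) = (a <= x.+1 <= b)%N && within a b pi.
Proof. by rewrite /within (perm_all _ (perm_insert x pi)). Qed.

(** Deleting one copy of x is a bijection, with inverse inserting x.  Taking x
    to be the least or the greatest allowed part gives the two recurrences
    below. *)
Lemma parts_between_with_part a b x n : (0 < x)%N -> (a <= x <= b)%N ->
  partition_series (fun pi => within a b pi && (x \in parts pi)) n
  = shift x (parts_between a b) n.
Proof.
case: x => // x _ axb; rewrite /shift.
case: (leqP x.+1 n) => [xn|nx]; last first.
  rewrite /partition_series big_seq_cond big1 // => pi /and3P[].
  rewrite mem_partitions => /eqP wpi _ xpi; exfalso; move: nx.
  by rewrite -wpi -(deleteK xpi) weight_insert; lia.
rewrite /parts_between /partition_series -[LHS]big_filter -[RHS]big_filter.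
rewrite -[RHS](@big_map _ _ _ _ _ (insert x) _ xpredT (fun _ => 1)).
apply: perm_big; apply: uniq_perm.
- exact/filter_uniq/partitions_uniq.
- rewrite map_inj_uniq; last exact: can_inj (@insertK x).
  exact/filter_uniq/partitions_uniq.
move=> pi; rewrite mem_filter mem_partitions.
apply/idP/mapP => [/andP[/andP[wi xpi] /eqP wpi]|[rho]].
  exists (delete x.+1 pi); last by rewrite deleteK.
  move: wi wpi; rewrite -{1 2}(deleteK xpi) within_insert weight_insert.
  rewrite mem_filter mem_partitions => /andP[_ ->] /= <-; apply/eqP; lia.
rewrite mem_filter mem_partitions => /andP[wi /eqP wrho] ->.
rewrite within_insert axb wi weight_insert wrho subnKC // eqxx andbT /=.
by rewrite mem_sort mem_head.
Qed.

Lemma parts_between_ge0 a b n : 0 <= parts_between a b n.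
Proof. exact: partition_series_ge0. Qed.

Lemma parts_between_remove_min a b n : (0 < a <= b)%N ->
  parts_between a b n = parts_between a.+1 b n + shift a (parts_between a b) n.
Proof.
case/andP=> a0 ab; rewrite -parts_between_with_part ?leqnn //.
rewrite [LHS](partition_series_split _ (fun pi => a \in parts pi)) addrC.
congr (_ + _); apply: eq_partition_series => pi _.
rewrite -has_pred1 -all_predC /within -all_predI; apply: eq_all => x /=; lia.
Qed.

Lemma parts_between_remove_max a b n : (a <= b.+1)%N ->
  parts_between a b.+1 n
  = parts_between a b n + shift b.+1 (parts_between a b.+1) n.
Proof.
move=> ab; rewrite -parts_between_with_part ?ab ?leqnn //.
rewrite [LHS](partition_series_split _ (fun pi => b.+1 \in parts pi)) addrC.
congr (_ + _); apply: eq_partition_series => pi _.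
rewrite -has_pred1 -all_predC /within -all_predI; apply: eq_all => x /=; lia.
Qed.

Lemma parts_between_add_part a b k n : (0 < k)%N -> (a <= k <= b)%N ->
  parts_between a b n <= parts_between a b (n + k).
Proof.
move=> k0 kb.
rewrite [leRHS](partition_series_split _ (fun pi => k \in parts pi)).
rewrite parts_between_with_part // /shift leq_addl addnK lerDl.
exact: partition_series_ge0.
Qed.

Lemma part_le_weight (pi : int_partition) x :
  x \in parts pi -> (x <= weight pi)%N.
Proof.
rewrite /weight; elim: (parts pi) => //= y s IH.
by rewrite inE => /predU1P[->|/IH]; lia.
Qed.

(** Only the empty partition is left. *)
Lemma parts_between_trivial a b n :
  (0 < a)%N -> (b < a)%N || (n < a)%N -> parts_between a b n = fps_qpow 0 n.
Proof.
move=> a0 ab.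
have empty (pi : int_partition) :
    weight pi = n -> within a b pi = (parts pi == [::]).
  move=> wpi; apply/idP/eqP => [wi|]; last by rewrite /within => ->.
  case pi0: (parts pi) => [//|x s].
  have xpi : x \in parts pi by rewrite pi0 mem_head.
  by have := allP wi _ xpi; have := part_le_weight xpi; lia.
rewrite /parts_between (eq_partition_series empty) /fps_qpow /partition_series.
have nilP : is_partition [::] by [].
have nilE (pi : int_partition) :
  (parts pi == [::]) = (pi == IntPartition nilP) by [].
under eq_bigl => pi do rewrite nilE.
rewrite -big_filter.
have [->|n0] := eqVneq n 0%N.
  rewrite (perm_big [:: IntPartition nilP]) ?big_seq1 //.
  apply: uniq_perm => //; first exact/filter_uniq/partitions_uniq.
  move=> pi; rewrite mem_filter mem_partitions inE.
  by case: eqP => //= ->.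
rewrite big_filter big_seq_cond big1 // => pi /andP[].
by rewrite mem_partitions => + /eqP pi0; rewrite pi0 eq_sym (negPf n0).
Qed.

(** * Partitions with bounded difference between largest and smallest part *)

Definition narrow (L m : nat) : fps :=
  partition_series (fun pi =>
    [&& in_mho pi, m <= smallest pi & largest pi - smallest pi <= L]%N).

(** Partitions with smallest part m and difference at most L are an instance of
    [parts_between_with_part]. *)
Lemma narrow_min (L m : nat) pi : (0 < m)%N ->
  [&& in_mho pi, smallest pi == m & largest pi - smallest pi <= L]%N
  = within m (m + L) pi && (m \in parts pi).
Proof.
move=> m0; apply/and3P/andP => [[pi0 /eqP sm lL]|[/allP wi mpi]].
  split; last by rewrite -sm smallest_in.
  apply/allP => x xpi; move: (smallest_min xpi) (largest_max xpi); lia.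
have pi0 : in_mho pi by have := part_le_weight mpi; rewrite /in_mho; lia.
have := wi _ (smallest_in pi0); have := wi _ (largest_in pi0).
have := smallest_min mpi.
by move=> ? ? ?; split => //; lia.
Qed.

Lemma narrow_remove_min L m n : (0 < m)%N ->
  narrow L m n = narrow L m.+1 n + shift m (parts_between m (m + L)) n.
Proof.
move=> m0; rewrite -parts_between_with_part //; last lia.
rewrite [LHS](partition_series_split _ (fun pi => smallest pi == m)) addrC.
congr (_ + _); apply: eq_partition_series => pi _; last rewrite -narrow_min //.
  by rewrite -andbA; case: (in_mho pi) => //=; apply/idP/idP; lia.
by rewrite -andbA; case: (in_mho pi) => //=; apply/idP/idP; lia.
Qed.

(** The equation narrow = (p_m - 1) / (1 - q^(L+1)), p_m counting the partitions
    with parts in [m, m + L].  By downward induction on m it suffices that both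
    sides change alike from m to m + 1.  Splitting the partitions with parts in
    [m, m + L + 1] by their least and by their greatest allowed part gives
      p_m - p_(m+1) = (q^m - q^(m+L+1)) * (series for [m, m + L + 1]),
    which is that change. *)
Lemma narrow_rec L m n : (0 < m)%N ->
  narrow L.+1 m n
  = parts_between m (m + L) n - fps_qpow 0 n + shift L.+1 (narrow L.+1 m) n.
Proof.
have [k] := ubnP (n.+1 - m); elim: k m => // k IH m nk m0.
(* The downward induction starts above n, where no partition of n has parts. *)
have [nm|mn] := ltnP n m.
  have zero j : (j < m)%N -> narrow L.+1 m j = 0.
    move=> jm; rewrite /narrow /partition_series big_seq_cond big1 // => pi.
    case/and4P; rewrite mem_partitions => /eqP wpi pi0 mle _; exfalso.
    by have := part_le_weight (smallest_in pi0); lia.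
  rewrite parts_between_trivial ?nm ?orbT // zero // /shift.
  by case: ifP => _; rewrite ?zero ?subrr ?addr0 //; lia.
rewrite narrow_remove_min // IH //; last lia.
have := parts_between_remove_max n (_ : m <= (m + L).+1)%N.
have := @parts_between_remove_min m (m + L.+1) n.
rewrite addnS addSn => /(_ ltac:(lia)) -> /(_ ltac:(lia)).
have -> : shift L.+1 (narrow L.+1 m) n
   = shift L.+1 (narrow L.+1 m.+1) n
     + shift (m + L).+1 (parts_between m (m + L).+1) n.
  have -> : shift (m + L).+1 = shift (L.+1 + m) by congr shift; lia.
  rewrite -shift_comp /shift; case: ifP => _; rewrite ?addr0 //.
  by rewrite narrow_remove_min // addnS.
lia.
Qed.

(** * The estimate of p by three of its shifts *)

(** The series (q^2 + q^4 + q^6 - 1) * p + 1 + q^3 for parts in [3, M]; the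
    corrections 1 and q^3 are there because n = 0 and n = 3 violate the estimate
    without them. *)
Definition excess (M : nat) : fps := fun n =>
  shift 2 (parts_between 3 M) n + shift 4 (parts_between 3 M) n
  + shift 6 (parts_between 3 M) n
  - parts_between 3 M n + fps_qpow 0 n + fps_qpow 3 n.

Lemma shift_parts_between_remove_max j M n : (2 <= M)%N ->
  shift j (parts_between 3 M.+1) n
  = shift j (parts_between 3 M) n
    + shift M.+1 (shift j (parts_between 3 M.+1)) n.
Proof.
move=> M2; rewrite shift_comp addnC -shift_comp; apply: shift_add => m.
exact: parts_between_remove_max.
Qed.

(** Passing from M to M + 1 divides p by 1 - q^(M+1), while the summand 1 + q^3
    of the excess stays as it is. *)
Lemma excess_rec M n : (2 <= M)%N ->
  excess M.+1 n = excess M n + shift M.+1 (excess M.+1) n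
                  - fps_qpow M.+1 n - fps_qpow M.+4 n.
Proof.
move=> M2; rewrite {1}/excess !(shift_parts_between_remove_max _ _ M2).
rewrite {1}(parts_between_remove_max _ (_ : 3 <= M.+1)%N) // /excess.
rewrite -[in fps_qpow M.+1 n](addn0 M.+1) -[M.+4](addn3 M.+1) -!shift_qpow.
have shiftM f :
  shift M.+1 f n = if (M.+1 <= n)%N then f (n - M.+1)%N else 0 by [].
by rewrite !shiftM; case: ifP => _; lia.
Qed.

(** (q^2 + q^4) / (1 - q^3): the factor 1 - q^3 cancels against
    q^6 - 1 = - (1 + q^3) * (1 - q^3). *)
Lemma excess_3 n : excess 3 n = ((n != 1) && ~~ (3 %| n))%N%:R.
Proof.
have base m :
    excess 2 m = fps_qpow 2 m + fps_qpow 4 m + fps_qpow 6 m + fps_qpow 3 m.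
  have e j : shift j (parts_between 3 2) m = fps_qpow j m.
    rewrite -[in RHS](addn0 j) -shift_qpow /shift; case: ifP => // _.
    exact: parts_between_trivial.
  by rewrite /excess !e parts_between_trivial // addrNK.
have [k] := ubnP n; elim: k n => // k IH n nk.
rewrite excess_rec // base /shift.
case: (leqP 3 n) => [n3|]; last by case: n nk => [|[|[|]]].
rewrite IH; last lia.
have [->//|n4] := eqVneq n 4%N.
rewrite dvdn_subl // /fps_qpow (negPf n4).
have -> : (n == 2)%N = false by lia.
have -> : (n - 3 != 1)%N = (n != 1)%N by lia.
lia.
Qed.

(** The excess for M = 4 is (q^2 + q^10) / ((1 - q^3) * (1 - q^4)).  The
    induction on M starts here: for M = 3 the excess vanishes at every multiple
    of 3, so its coefficients are not all positive from any degree on. *)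
Lemma excess_4_bounds n :
  0 <= excess 4 n
  /\ ([|| n == 2, n == 5, n == 6 | 8 <= n]%N -> 1 <= excess 4 n).
Proof.
have rec m :
    excess 4 m
    = excess 3 m + shift 4 (excess 4) m - fps_qpow 4 m - fps_qpow 7 m.
  exact: excess_rec.
have ge0 m : 0 <= excess 4 m.
  have [k] := ubnP m; elim: k m => // k IH m mk.
  rewrite rec excess_3; have [->|m4] := eqVneq m 4%N.
    by rewrite /shift rec excess_3.
  have [->|m7] := eqVneq m 7%N; first by rewrite /shift rec excess_3.
  rewrite /fps_qpow (negPf m4) (negPf m7) !subr0 addr_ge0 ?ler0n // /shift.
  by case: ifP => // m4'; apply: IH; lia.
(* Away from the multiples of 3 the excess for M = 3 suffices; a multiple of 3
   is reduced to that case by removing one part 4. *)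
have ge1 m :
    m \in [:: 2; 5]%N \/ (8 <= m)%N /\ ~~ (3 %| m)%N -> 1 <= excess 4 m.
  rewrite !inE => mP; rewrite rec excess_3 /fps_qpow.
  have -> : (m != 1)%N && ~~ (3 %| m)%N by lia.
  have -> : (m == 4)%N = false by lia.
  have -> : (m == 7)%N = false by lia.
  by rewrite !subr0 lerDl shift_ge0.
split=> // nP.
have [d3|d3] := boolP (3 %| n)%N; last by apply: ge1; rewrite !inE; lia.
rewrite rec excess_3 d3 andbF add0r /fps_qpow /shift.
have -> : (n == 4)%N = false by lia.
have -> : (n == 7)%N = false by lia.
rewrite ifT; last lia.
by rewrite !subr0; apply: ge1; rewrite !inE; lia.
Qed.

(** By [excess_rec], passing from M to M + 1 costs one unit in degrees M + 1 and
    M + 4 only, so these degrees must stay positive beforehand.  Degree M + 2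
    becomes the next degree (M + 1) + 1.  Degree M + 3 is not known to be
    positive for M, but becomes so for M + 1, since 2 is a positive degree and
    M + 3 = 2 + (M + 1); it is then the next (M + 1) + 2. *)
Lemma excess_bounds M n : (4 <= M)%N ->
  0 <= excess M n
  /\ ([|| n == 2, n == M.+1, n == M.+2 | M.+4 <= n]%N -> 1 <= excess M n).
Proof.
elim: M n => // M IH n; rewrite leq_eqVlt => /predU1P[<-|M4].
  exact: excess_4_bounds.
have M2 : (2 <= M)%N by lia.
have ge0 m : 0 <= excess M.+1 m.
  have [k] := ubnP m; elim: k m => // k IHk m mk.
  rewrite excess_rec // /fps_qpow.
  have sh0 : 0 <= shift M.+1 (excess M.+1) m.
    by rewrite /shift; case: ifP => // mM; apply: IHk; lia.
  have [e0 e1] := IH m M4.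
  have [mM|mM] := boolP ((m == M.+1) || (m == M.+4)); last by lia.
  have := e1 ltac:(lia); lia.
have ge1 m : [|| m == 2, m == M.+2 | M.+4 < m]%N -> 1 <= excess M.+1 m.
  move=> mP; rewrite excess_rec // /fps_qpow.
  have -> : (m == M.+1)%N = false by lia.
  have -> : (m == M.+4)%N = false by lia.
  have [_ e1] := IH m M4; have sh0 := shift_ge0 M.+1 m ge0.
  have := e1 ltac:(lia); lia.
(* Degree M + 3 inherits the positive coefficient of degree 2. *)
split=> // nP; have [->|n3] := eqVneq n M.+3; last by apply: ge1; lia.
rewrite excess_rec // /fps_qpow /shift ifT; last lia.
have -> : (M.+3 - M.+1 = 2)%N by lia.
have [e0 _] := IH M.+3 M4; have := ge1 2%N isT; lia.
Qed.

Lemma parts_between_ge3_le_three_steps M n : (4 <= M)%N ->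
  parts_between 3 M n
  <= shift 2 (parts_between 3 M) n + shift 4 (parts_between 3 M) n
     + shift 6 (parts_between 3 M) n + fps_qpow 0 n + fps_qpow 3 n.
Proof. by move=> /(@excess_bounds _ n)[]; rewrite /excess; lia. Qed.

(** * Comparison of the two halves *)

Definition smallest2 (M : nat) : fps := shift 2 (parts_between 2 M).

Lemma smallest2_rec M n : (2 <= M)%N ->
  smallest2 M n = shift 2 (parts_between 3 M) n + shift 2 (smallest2 M) n.
Proof.
by move=> M2; apply: shift_add => m; apply: parts_between_remove_min.
Qed.

(** In p * (q^2 + q^4 + ...), the terms before the one at 2(i + 1) are
    nonnegative and can be dropped. *)
Lemma smallest2_ge M i n : (2 <= M)%N ->
  shift i.+1.*2 (parts_between 3 M) n + shift i.+1.*2 (smallest2 M) n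
  <= smallest2 M n.
Proof.
move=> M2; elim: i n => [|i IH] n; rewrite [leRHS]smallest2_rec //.
have -> : i.+2.*2 = (2 + i.+1.*2)%N by lia.
rewrite -!shift_comp.
have sh0 : 0 <= shift 2 (parts_between 3 M) n.
  by apply: shift_ge0 => m; apply: parts_between_ge0.
apply: (@le_trans _ _ (shift 2 (smallest2 M) n)); last by rewrite lerDr.
by rewrite /shift; case: ifP => // _; apply: IH.
Qed.

(** Strong induction in steps of 2L: an even step is a whole number of terms of
    [smallest2], and two steps of [narrow_rec].  Odd and even L are treated
    together through the choice of e below. *)
Lemma narrow_le_smallest2 L n : (11 <= L)%N ->
  narrow L 3 n <= smallest2 L.+2 n + fps_qpow 3 n.
Proof.
(* From here on L + 1 stands for the bound on the difference of parts. *)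
case: L => // L L11; have [k] := ubnP n; elim: k n => // k IH n nk.
set p := parts_between 3 L.+3; set E := smallest2 L.+3; set B := narrow L.+1 3.
have pE : parts_between 3 (3 + L) = p by rewrite addnC addn3.
have Brec m : B m = p m - fps_qpow 0 m + shift L.+1 B m.
  by rewrite /B narrow_rec // pE.
have p0 m : 0 <= p m by apply: parts_between_ge0.
have shp0 j m : 0 <= shift j p m by apply: shift_ge0.
(* The even distance at which p(n - (L + 1)) is absorbed; it must exceed the
   distances 2, 4 and 6 used by p(n). *)
pose e := if odd L then L.+1 else (L - 2)%N.
have [e8 eL e2] : [/\ 8 <= e, e <= L.+1 & ~~ odd e]%N.
  by rewrite /e; case: ifP => oL; split; rewrite /= ?oL ?oddB ?oL //; lia.
have p_mono : shift L.+1 p n <= shift e p n.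
  rewrite /shift; case: (leqP L.+1 n) => nL; last exact: (shp0 e n).
  rewrite ifT; last lia.
  have [eL1|eL1] := eqVneq e L.+1; first by rewrite eL1.
  have -> : (n - e = n - L.+1 + 3)%N by move: eL1; rewrite /e; case: ifP; lia.
  by apply: parts_between_add_part.
have E6 : E n = shift 2 p n + shift 4 p n + shift 6 p n + shift 6 E n.
  have M2 : (2 <= L.+3)%N by [].
  have step j : shift j E n = shift (j + 2) p n + shift (j + 2) E n.
    by rewrite -!shift_comp; apply: shift_add => m; apply: smallest2_rec.
  have E4 : shift 2 E n = shift 4 p n + shift 4 E n := step 2.
  have E6 : shift 4 E n = shift 6 p n + shift 6 E n := step 4.
  rewrite [LHS]smallest2_rec // -/p -/E E4 E6; lia.
have Ee : shift e p n + shift e E n <= shift 6 E n.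
  rewrite [e](_ : _ = 6 + (e./2 - 4).+1.*2)%N; last first.
    by rewrite -{1}(even_halfK e2); lia.
  rewrite -!shift_comp /shift; case: ifP => // _.
  exact: smallest2_ge.
have EL : shift L.+1.*2 p n + shift L.+1.*2 E n <= shift e E n.
  have -> : L.+1.*2 = (e + (L - e./2).+1.*2)%N.
    by rewrite -{1}(even_halfK e2); lia.
  rewrite -!shift_comp /shift; case: ifP => // _.
  exact: smallest2_ge.
have B2 : B n = p n - fps_qpow 0 n + shift L.+1 p n - fps_qpow L.+1 n
                + shift L.+1.*2 B n.
  rewrite [LHS]Brec -addnn -shift_comp.
  rewrite -[in fps_qpow L.+1 n](addn0 L.+1) -shift_qpow.
  have shiftL f :
    shift L.+1 f n = if (L.+1 <= n)%N then f (n - L.+1)%N else 0 by [].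
  by rewrite !shiftL; case: ifP => _; rewrite ?(Brec (n - L.+1)%N); lia.
have IHn : shift L.+1.*2 B n <= shift L.+1.*2 p n + shift L.+1.*2 E n.
  rewrite /shift; case: ifP => // Ln; have := IH (n - L.+1.*2)%N ltac:(lia).
  rewrite -/B -/E /fps_qpow; have [->|_] := eqVneq _ 3%N.
    (* The correction at 3 for n - 2(L + 1) is paid by the partition 3 of 3. *)
    have : p 0%N <= p 3%N by apply: (@parts_between_add_part 3 L.+3 3 0).
    by rewrite {1}/p parts_between_trivial // /fps_qpow; lia.
  have := p0 (n - L.+1.*2)%N; lia.
have key := @parts_between_ge3_le_three_steps L.+3 n ltac:(lia).
have q0 : 0 <= fps_qpow L.+1 n by rewrite /fps_qpow ler0n.
rewrite -/p in key; rewrite B2 E6; lia.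
Qed.

Theorem theorem18 :
  forall L : nat, (11 <= L)%N ->
  forall n : nat, 0 <= fps_add (G2 L) (fps_qpow 3) n.
Proof.
move=> L L11 n; rewrite /fps_add /G2 /fps_sub -/(narrow L 3).
rewrite (eq_partition_series (fun pi _ => narrow_min L pi (isT : 0 < 2)%N)).
rewrite parts_between_with_part // add2n.
by have := narrow_le_smallest2 n L11; rewrite /smallest2; lia.
Qed.
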